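(* There is an absolute constant $C>0$ such that the following holds. Let $\mathcal{K}\subset\mathbb{R}^d$ be a $\rho$-smooth convex body, and let $0<r\le\rho\le R$ be known radii with $\mathbb{B}(0,r)\subseteq\mathcal{K}\subseteq\mathbb{B}(0,R)$. Let $x\in\mathcal{K}$, let $y\notin\mathcal{K}$ satisfy $\|y-x\|\le 2R$, and let $q$ be the last feasible point on $[x,y]$, i.e. the point of $[x,y]\cap\mathcal{K}$ farthest from $x$. For every $0<\delta\le r$, there is a deterministic algorithm using queries to the exact membership oracle of $\mathcal{K}$ that returns a point $\widehat q\in[x,q]$ (in particular $\widehat q\in\mathcal{K}$) and a unit vector $\widetilde n$ satisfying $$\|\widehat q-q\|\le\delta,\qquad \|\widetilde n-n(q)\|\le\frac{\delta}{2R+\rho},$$ where $n(q)$ is the outward unit normal to $\mathcal{K}$ at $q$. It uses at most $$C\,d\log\Big(d+\frac{R}{r}+\frac{R}{\delta}\Big)$$ membership queries.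
   Context: $\|\cdot\|$ and $\langle\cdot,\cdot\rangle$ are the Euclidean norm and inner product on $\mathbb{R}^d$; $\mathbb{B}(x,s)$ is the closed Euclidean ball of radius $s$ centered at $x$. A convex body is a compact convex set with nonempty interior. An outward supporting unit normal to $\mathcal{K}$ at $q\in\partial\mathcal{K}$ is a unit vector $n$ with $\langle n,z-q\rangle\le 0$ for all $z\in\mathcal{K}$. A convex body $\mathcal{K}$ is $\rho$-smooth if for every $q\in\partial\mathcal{K}$ and every outward supporting unit normal $n$ at $q$ one has $\mathbb{B}(q-\rho n,\rho)\subseteq\mathcal{K}$; for such a body the outward unit normal at each boundary point $q$ is unique and denoted $n(q)$. The exact membership oracle, given $z\in\mathbb{R}^d$, returns $\mathbf{1}\{z\in\mathcal{K}\}$. The algorithm is a single procedure whose input is $x,y,\delta$ and the known parameters $d,\rho,r,R$; it does exact real arithmetic, its queries may be adaptive, and it accesses $\mathcal{K}$ only through the membership oracle. *)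

(* Defs.v *)
From HB Require Import structures.
From mathcomp Require Import all_boot all_order all_algebra.
From mathcomp Require Import all_classical all_reals all_analysis.

Set Implicit Arguments.
Unset Strict Implicit.
Unset Printing Implicit Defensive.

Import Order.TTheory GRing.Theory Num.Theory.
Import numFieldNormedType.Exports.

Local Open Scope classical_set_scope.
Local Open Scope ring_scope.

Section Euclidean.
Variables (R : realType) (d : nat).
Implicit Types (u v x y z q n : 'rV[R]_d) (K : set 'rV[R]_d).

Definition inner u v : R := \sum_(i < d) u 0 i * v 0 i.

(* The library norm [`|u|] and [closed_ball] on ['rV[R]_d] are those of the
   sup norm, hence the separate Euclidean versions. The topology is the same,
   so [compact], [interior] and [closure] are the library's. *)
Definition enorm u : R := Num.sqrt (inner u u).

Definition eball x (s : R) : set 'rV[R]_d := [set z | enorm (z - x) <= s].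

Definition segment x y : set 'rV[R]_d :=
  [set (1 - t) *: x + t *: y | t in `[0 : R, 1]].

Definition boundary K : set 'rV[R]_d := closure K `\` interior K.

Definition convex_body K : Prop :=
  [/\ compact K, convex_set (K : set (convex_lmodType 'rV[R]_d))
    & interior K !=set0].

Definition supporting_unit_normal K q n : Prop :=
  enorm n = 1 /\ forall z, K z -> inner n (z - q) <= 0.

Definition smooth_body (rho : R) K : Prop :=
  convex_body K /\
  forall q n, boundary K q -> supporting_unit_normal K q n ->
    eball (q - rho *: n) rho `<=` K.

(* The normal n(q). It is meaningful when [q] is a boundary point of a
   rho-smooth body with rho > 0, where there is exactly one supporting unit
   normal; [get] returns an unspecified vector if there is none. *)
Definition outward_normal K q : 'rV[R]_d :=
  get [set n | supporting_unit_normal K q n].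

(* [q] is the point of [x, y] `&` K farthest from [x]. *)
Definition last_feasible K x y q : Prop :=
  (segment x y `&` K) q /\
  forall z, (segment x y `&` K) z -> enorm (z - x) <= enorm (q - x).

End Euclidean.

(* Deterministic adaptive algorithms with a yes/no oracle on [T] and output in
   [A], as decision trees: the next query, or the output, depends only on the
   oracle answers received so far. Computation between queries is exact and
   free. *)
Inductive query_alg (T A : Type) : Type :=
| Return of A
| Query of T & (bool -> query_alg T A).

Fixpoint output (T A : Type) (o : T -> bool) (t : query_alg T A) : A :=
  match t with
  | Return a => a
  | Query z k => output o (k (o z))
  end.

Fixpoint num_queries (T A : Type) (o : T -> bool) (t : query_alg T A) : nat :=
  match t with
  | Return _ => 0%N
  | Query z k => (num_queries o (k (o z))).+1
  end.

Definition membership_oracle (R : realType) (d : nat) (K : set 'rV[R]_d) :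
  'rV[R]_d -> bool := fun z => `[< K z >].

(* Main.v *)
Require Import Defs.
From HB Require Import structures.
From mathcomp Require Import all_boot all_order all_algebra.
From mathcomp Require Import all_classical all_reals all_analysis.
From mathcomp Require Import ring lra.

(** The gauge [p] of [K] satisfies [p q = 1] and has gradient [n / <n, q>] at
    [q], where [n] is the normal at [q]: the supporting half-space bounds [p]
    from below by its linearization, and the ball of radius [rho] inside [K]
    touching the boundary at [q] bounds it from above up to a quadratic term.
    One bisection on [[x, y]] gives a point [qhat] very close to [q], and one
    bisection along the ray through [qhat + s e_i] gives the [i]-th finite
    difference of [p]. Normalizing the vector of finite differences gives the
    approximate normal. The step [s] and the accuracy of the [d + 1] bisections
    are polynomial in the parameters, so that each of them takes
    [O(log (d + R/r + R/delta))] queries. The normal itself exists by the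
    supporting hyperplane theorem (nearest points and compactness of the
    sphere). *)

Import Order.TTheory GRing.Theory Num.Theory.
Import numFieldNormedType.Exports.

Set Implicit Arguments.
Unset Strict Implicit.

Local Open Scope classical_set_scope.
Local Open Scope ring_scope.

(** * Euclidean inner product and norm *)

Section Euclid.
Variables (R : realType) (d : nat).
Implicit Types (u v w x y z q n : 'rV[R]_d) (K : set 'rV[R]_d).

Lemma innerC u v : inner u v = inner v u.
Proof. by apply: eq_bigr => i _; rewrite mulrC. Qed.

Lemma innerDl u v w : inner (u + v) w = inner u w + inner v w.
Proof.
by rewrite /inner -big_split; apply: eq_bigr => i _; rewrite !mxE mulrDl.
Qed.

Lemma innerZl (a : R) u v : inner (a *: u) v = a * inner u v.
Proof.
by rewrite /inner mulr_sumr; apply: eq_bigr => i _; rewrite !mxE mulrA.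
Qed.

Lemma innerNl u v : inner (- u) v = - inner u v.
Proof. by rewrite -scaleN1r innerZl mulN1r. Qed.

Lemma innerDr u v w : inner u (v + w) = inner u v + inner u w.
Proof. by rewrite innerC innerDl !(innerC _ u). Qed.

Lemma innerZr (a : R) u v : inner u (a *: v) = a * inner u v.
Proof. by rewrite innerC innerZl innerC. Qed.

Lemma innerNr u v : inner u (- v) = - inner u v.
Proof. by rewrite innerC innerNl innerC. Qed.

Definition innerE := (innerDl, innerDr, innerNl, innerNr, innerZl, innerZr).

Lemma inner_ge0 u : 0 <= inner u u.
Proof. by apply: sumr_ge0 => i _; rewrite -expr2 sqr_ge0. Qed.

Lemma inner_eq0 u : (inner u u == 0) = (u == 0).
Proof.
rewrite psumr_eq0 => [|i _]; last by rewrite -expr2 sqr_ge0.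
apply/allP/eqP => [u0|-> i _]; last by rewrite mxE mulr0 eqxx.
apply/rowP => i; rewrite mxE; apply/eqP.
by have := u0 i (mem_index_enum i); rewrite mulf_eq0 orbb.
Qed.

Lemma inner_delta u i : inner u (delta_mx 0 i) = u 0 i.
Proof.
rewrite /inner (bigD1 i) //= big1 => [|j ji].
  by rewrite mxE !eqxx mulr1 addr0.
by rewrite mxE (negPf ji) andbF mulr0.
Qed.

Lemma enorm_ge0 u : 0 <= enorm u.
Proof. exact: sqrtr_ge0. Qed.

Lemma sqr_enorm u : enorm u ^+ 2 = inner u u.
Proof. by rewrite sqr_sqrtr // inner_ge0. Qed.

Lemma enorm0_eq0 u : enorm u = 0 -> u = 0.
Proof. by move=> u0; apply/eqP; rewrite -inner_eq0 -sqr_enorm u0 expr0n. Qed.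

Lemma enormZ (a : R) u : enorm (a *: u) = `|a| * enorm u.
Proof.
by rewrite /enorm innerZl innerZr mulrA -expr2 sqrtrM ?sqr_ge0 // sqrtr_sqr.
Qed.

Lemma enormN u : enorm (- u) = enorm u.
Proof. by rewrite /enorm innerNl innerNr opprK. Qed.

Lemma enormB u v : enorm (u - v) = enorm (v - u).
Proof. by rewrite -enormN opprB. Qed.

Lemma enorm_delta (i : 'I_d) : enorm (delta_mx 0 i : 'rV[R]_d) = 1.
Proof. by rewrite /enorm inner_delta mxE !eqxx sqrtr1. Qed.

Lemma cauchy_schwarz u v : `|inner u v| <= enorm u * enorm v.
Proof.
rewrite -(ler_pXn2r (n := 2)) ?nnegrE ?mulr_ge0 ?enorm_ge0 //.
rewrite real_normK ?num_real // exprMn !sqr_enorm.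
have [v0|v0] := eqVneq v 0.
  by rewrite v0 -(scale0r 0) innerZr innerZl !mul0r expr0n mulr0.
have vv : 0 < inner v v by rewrite lt_def inner_eq0 v0 inner_ge0.
(* This square is [inner v v] times the gap between the two sides of the squared inequality. *)
have := inner_ge0 (inner v v *: u - inner u v *: v).
rewrite !innerE (innerC v u) => h.
rewrite -subr_ge0 -(pmulr_rge0 _ vv); apply: le_trans h _.
by rewrite le_eqVlt; apply/orP; left; apply/eqP; ring.
Qed.

Lemma ler_inner u v : inner u v <= enorm u * enorm v.
Proof. exact: le_trans (ler_norm _) (cauchy_schwarz u v). Qed.

Lemma ler_enormD u v : enorm (u + v) <= enorm u + enorm v.
Proof.
rewrite -(ler_pXn2r (n := 2)) ?nnegrE ?addr_ge0 ?enorm_ge0 //.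
rewrite sqrrD !sqr_enorm !innerE (innerC v u).
have := ler_inner u v; lra.
Qed.

(** The factor [d] in place of its square root only affects the constant in the final query
    count. *)
Lemma enorm_le_coord u (e : R) : 0 <= e ->
  (forall i, `|u 0 i| <= e) -> enorm u <= d%:R * e.
Proof.
move=> e0 ue.
rewrite -(ler_pXn2r (n := 2)) ?nnegrE ?mulr_ge0 ?enorm_ge0 //.
rewrite sqr_enorm exprMn; apply: (@le_trans _ _ (d%:R * e ^+ 2)).
  rewrite mulr_natl -[X in _ *+ X](card_ord d) -sumr_const.
  apply: ler_sum => i _.
  by rewrite -expr2 -(real_normK (num_real (u 0 i))) ler_pXn2r ?nnegrE.
apply: ler_wpM2r; first exact: sqr_ge0.
by rewrite -natrX ler_nat; case: (d) => // m; rewrite leq_pmulr.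
Qed.

(* The factor 2: normalizing moves [a *: u] by at most another [e]. *)
Lemma normalize_close u n (a e : R) : 0 < a -> enorm n = 1 -> e < 1 ->
  enorm (a *: u - n) <= e ->
  enorm ((enorm u)^-1 *: u) = 1 /\
  enorm ((enorm u)^-1 *: u - n) <= 2 * e.
Proof.
move=> a0 n1 e1 une.
(* [h1] and [h2] place the length of [a *: u] within [e] of 1; with [e < 1] this also excludes
   [u = 0]. *)
have h1 : 1 <= enorm (a *: u) + e.
  rewrite -n1 -[in leLHS](subrKC (a *: u) n).
  by apply: le_trans (ler_enormD _ _) _; rewrite lerD2l enormB.
have h2 : enorm (a *: u) <= 1 + e.
  rewrite -n1 -[in leLHS](subrKC n (a *: u)).
  by apply: le_trans (ler_enormD _ _) _; rewrite lerD2l.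
have u0 : 0 < enorm u.
  have: 0 < enorm (a *: u) by lra.
  by rewrite enormZ pmulr_rgt0 ?normr_gt0 ?gt_eqF.
split; first by rewrite enormZ ger0_norm ?invr_ge0 ?enorm_ge0 // mulVf ?gt_eqF.
rewrite enormZ gtr0_norm // in h1 h2.
rewrite -(subrKA (a *: u)).
apply: le_trans (ler_enormD _ _) _.
rewrite -scalerBl enormZ.
have -> : (enorm u)^-1 - a = (1 - a * enorm u) / enorm u.
  by rewrite mulrBl mul1r mulfK ?gt_eqF.
rewrite normrM normfV (gtr0_norm u0) divfK ?gt_eqF //.
suff: `|1 - a * enorm u| <= e by lra.
by rewrite ler_norml; apply/andP; split; lra.
Qed.

(** * Continuity, compactness and existence of supporting normals *)

Lemma continuous_inner (T : topologicalType) (f g : T -> 'rV[R]_d) :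
  (forall i, continuous (fun t => f t 0 i)) ->
  (forall i, continuous (fun t => g t 0 i)) ->
  continuous (fun t => inner (f t) (g t)).
Proof.
move=> cf cg t; apply: (continuous_big (op := +%R)) => [t0|i _ t0].
  exact: add_continuous.
by apply: cvgM; [exact: cf|exact: cg].
Qed.

Lemma coord_subr_continuous w i : continuous (fun z : 'rV[R]_d => (z - w) 0 i).
Proof.
rewrite [X in continuous X]
  (_ : _ = (fun z : 'rV[R]_d => z 0 i - w 0 i)); last first.
  by apply/funext => z; rewrite !mxE.
move=> z; apply: (@continuousB _ R^o _ (fun z : 'rV[R]_d => z 0 i)).
  exact: (@coord_continuous R 1 d 0 i).
exact: cst_continuous.
Qed.

Lemma compact_sphere : compact [set n : 'rV[R]_d | inner n n = 1].
Proof.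
apply: (@subclosed_compact _ _
  [set n : 'rV[R]_d | forall i, `[-1 : R, 1]%classic (n ord0 i)]).
- apply: (@preimage_closed _ _ (fun n : 'rV[R]_d => inner n n) [set 1]).
    by move=> n _; apply: continuous_inner => i; exact: coord_continuous.
  exact: closed_eq.
- apply: (@rV_compact _ d (fun=> `[-1 : R, 1]%classic)) => i.
  exact: segment_compact.
- move=> n /= n1 i; rewrite in_itv /= -ler_norml.
  rewrite -inner_delta; apply: le_trans (cauchy_schwarz _ _) _.
  by rewrite enorm_delta mulr1 /enorm n1 sqrtr1.
Qed.

Lemma convex_bodyP K : convex_body K ->
  forall x y (t : R), K x -> K y -> 0 <= t -> t <= 1 ->
    K ((1 - t) *: x + t *: y).
Proof.
move=> [_ cK _] x y t Kx Ky t0 t1.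
(* The library's convex combination puts the weight on its first point, hence the order [y], [x]. *)
have := cK y x (Itv01 t0 t1); rewrite !inE => /(_ Ky Kx).
by rewrite addrC.
Qed.


(* The normal points from the nearest point of [K] to [w]. *)
Lemma separating_unit_normal K w : convex_body K -> ~ K w ->
  exists n, enorm n = 1 /\ forall z, K z -> inner n (z - w) <= 0.
Proof.
move=> bK Kw; have cK := convex_bodyP bK.
case: bK => compK _ [z0 /interior_subset Kz0].
have cd : continuous (fun z : 'rV[R]_d => inner (z - w) (z - w)).
  by apply: continuous_inner => i; exact: coord_subr_continuous.
have [|p] := compact_EVT_min _ compK (continuous_subspaceT cd).
  by exists z0.
rewrite inE => Kp pmin.
(* Variational inequality of the nearest point: at an acute angle, moving from [p] towards [z] would
   come closer to [w]. *)
have angle z : K z -> inner (w - p) (z - p) <= 0.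
  move=> Kz; rewrite leNgt; apply/negP => b0.
  set b := inner _ _ in b0; set c := inner (z - p) (z - p).
  have c0 : 0 <= c := inner_ge0 _.
  have hmin t : 0 <= t -> t <= 1 -> 2 * t * b <= t ^+ 2 * c.
    move=> t0 t1; have := pmin ((1 - t) *: p + t *: z); rewrite inE.
    move=> /(_ (cK _ _ _ Kp Kz t0 t1)).
    have -> : (1 - t) *: p + t *: z - w = t *: (z - p) - (w - p).
      rewrite scalerBl scale1r scalerBr !opprB.
      by apply/rowP => i; rewrite !mxE; ring.
    have -> : inner (p - w) (p - w) = inner (w - p) (w - p).
      by rewrite -opprB innerNl innerNr opprK.
    move: (z - p) (w - p) @b @c {b0 c0} => u v.
    rewrite !innerE (innerC v u) /=; lra.
  (* The minimizer of [t ^+ 2 * c - 2 * t * b] over [[0, 1]] is 1 or [b / c]; either one contradicts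
     [hmin]. *)
  have [cb|bc] := leP c b; first by have := hmin 1; lra.
  have c1 : 0 < c by lra.
  have bc0 : 0 <= b / c by rewrite divr_ge0 // ltW.
  have bc1 : b / c <= 1 by rewrite ler_pdivrMr // mul1r ltW.
  have := hmin _ bc0 bc1.
  have -> : 2 * (b / c) * b = 2 * (b ^+ 2 / c) by ring.
  have -> : (b / c) ^+ 2 * c = b ^+ 2 / c by field; rewrite gt_eqF.
  have : 0 < b ^+ 2 / c by rewrite divr_gt0 ?exprn_gt0.
  lra.
have wp : 0 < enorm (w - p).
  rewrite lt_def enorm_ge0 andbT; apply/eqP => /enorm0_eq0/eqP.
  by rewrite subr_eq0 => /eqP wp; apply: Kw; rewrite wp.
exists ((enorm (w - p))^-1 *: (w - p)); split.
  by rewrite enormZ ger0_norm ?invr_ge0 ?enorm_ge0 // mulVf ?gt_eqF.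
move=> z Kz; rewrite innerZl pmulr_rle0 ?invr_gt0 //.
rewrite -(subrKA p z) innerDr -(opprB w p) innerNr.
have := angle z Kz; have := inner_ge0 (w - p); lra.
Qed.

(** Separating [K] from outside points that tend to [q] gives unit vectors that support [K] at [q]
    up to an error tending to 0. A cluster point of them on the compact sphere supports [K]
    exactly. *)
Lemma supporting_unit_normal_exists K q : convex_body K -> 
  (forall e : R, 0 < e -> exists2 w, ~ K w & enorm (w - q) <= e) ->
  exists n, supporting_unit_normal K q n.
Proof.
move=> bK Kq.
have almost k : exists n, enorm n = 1 /\
    forall z, K z -> inner n (z - q) <= k.+1%:R^-1.
  have [|w Kw wq] := Kq k.+1%:R^-1; first by rewrite invr_gt0.
  have [n [n1 nw]] := separating_unit_normal bK Kw.
  exists n; split=> // z Kz; rewrite -(subrKA w z) innerDr -[leRHS]add0r.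
  apply: lerD; first exact: nw.
  by apply: le_trans (ler_inner _ _) _; rewrite n1 mul1r.
have /choice [f fP] := almost.
have [|n [/= n1 nclus]] := @compact_sphere (f @ \oo) _.
  by exists 0%N => // k _; rewrite /= -sqr_enorm (fP k).1 expr1n.
exists n; split; first by rewrite /enorm n1 sqrtr1.
move=> z Kz; rewrite leNgt; apply/negP => nz.
set e := inner n (z - q) in nz.
(* For [e > 0], vectors close to [n] give more than [e / 2] at [z], while [f k] eventually gives
   less. *)
have near_n : \forall m \near n, e / 2 < inner m (z - q).
  have cm : continuous (fun m : 'rV[R]_d => inner m (z - q)).
    apply: continuous_inner => i; first exact: coord_continuous.
    by move=> m; exact: cst_continuous.
  by apply: (cvgr_gt _ (cm n)); rewrite -/e; lra.
have e2 : 0 < e / 2 by rewrite divr_gt0.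
have far : (f @ \oo) [set m : 'rV[R]_d | inner m (z - q) < e / 2].
  apply: filterS (near_infty_natSinv_lt (PosNum e2)) => k /=.
  exact: le_lt_trans ((fP k).2 z Kz).
have [m [/= lo hi]] := nclus _ _ far near_n.
by move: (lt_trans hi lo); rewrite ltxx.
Qed.

End Euclid.

(** * The gauge near a boundary point *)

Section Gauge.
Variables (R : realType) (d : nat).
Implicit Types (u v w x y z q n : 'rV[R]_d) (K : set 'rV[R]_d).

(** An interior point could be moved slightly along [n] without leaving [K], against the support
    inequality. *)
Lemma boundary_supporting K q n : K q -> supporting_unit_normal K q n ->
  boundary K q.
Proof.
move=> Kq [n1 nK]; split; first exact: subset_closure.
move=> Kn; have cvq : (fun t : R => q + t *: n) @ (0 : R) --> q.
  have -> : nbhs q = nbhs (q + 0 *: n) by rewrite scale0r addr0.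
  by apply: cvgD; [exact: cvg_cst|apply: cvgZr_tmp; exact: cvg_id].
have /nbhs_ballP [e /= e0 eK] := cvq _ Kn.
have : K (q + (e / 2) *: n).
  apply: eK; rewrite /ball /= sub0r normrN gtr0_norm; lra.
move=> /nK; rewrite addrAC subrr add0r innerZr -sqr_enorm n1 expr1n mulr1; lra.
Qed.

(** Test the support inequality at [r *: n]. This keeps the denominator of the gauge gradient away
    from 0. *)
Lemma support_ge K q n (r : R) : 0 <= r -> eball 0 r `<=` K ->
  supporting_unit_normal K q n -> r <= inner n q.
Proof.
move=> r0 rK [n1 nK]; have := nK (r *: n).
rewrite innerDr innerNr innerZr -sqr_enorm n1 expr1n mulr1 subr_le0.
by apply; apply: rK; rewrite /eball /= subr0 enormZ n1 mulr1 ger0_norm.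
Qed.

(** [K (l^-1 *: z)] says that the gauge of [z] is at most [l], so this is the lower bound of the
    gauge by its linearization. *)
Lemma support_gauge_le K q n z (l : R) : 0 < l ->
  supporting_unit_normal K q n -> K (l^-1 *: z) ->
  inner n z <= l * inner n q.
Proof.
move=> l0 [_ nK] /nK; rewrite innerDr innerNr innerZr subr_le0.
by rewrite mulrC ler_pdivrMr // mulrC.
Qed.

(* [k] is the quadratic error of the linearized gauge: for [e = |v| / r] the
   hypotheses allow [k = 9 (e Rad / r)^2] when this is at most [e]. *)
Lemma gauge_le_quadratic K q n v (rho r Rad e k l : R) :
  convex_body K -> K 0 -> enorm n = 1 -> eball (q - rho *: n) rho `<=` K ->
  0 < r -> r <= rho -> r <= inner n q -> enorm q <= Rad -> r <= Rad ->
  enorm v <= e * r -> 0 <= e -> 2 * e <= 1 -> 0 <= k -> k <= e ->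
  9 * e ^+ 2 * Rad ^+ 2 <= r ^+ 2 * k ->
  1 + inner n v / inner n q + k <= l ->
  K (l^-1 *: (q + v)).
Proof.
move=> bK K0 n1 ballK r0 r_rho ra qRad r_Rad ve e0 e2 k0 ke ek.
set a := inner n q in ra *; set b := inner n v / a.
set l0 := 1 + b + k => l0l.
have a0 : 0 < a by lra.
have be : `|b| <= e.
  rewrite /b normrM normfV (gtr0_norm a0) ler_pdivrMr //.
  apply: le_trans (cauchy_schwarz _ _) _; rewrite n1 mul1r.
  by apply: le_trans ve _; apply: ler_wpM2l.
have l0_ge : 1 <= 2 * l0 by move: be; rewrite ler_norml /l0; lra.
have l0_gt0 : 0 < l0 by lra.
have l_gt0 : 0 < l by lra.
(* [K] is star-shaped about 0, so the smallest admissible value [l0] suffices. *)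
suff Kl0 : K (l0^-1 *: (q + v)).
  have t0 : 0 <= l0 / l by rewrite divr_ge0 ?ltW.
  have t1 : l0 / l <= 1 by rewrite ler_pdivrMr // mul1r.
  have := convex_bodyP bK K0 Kl0 t0 t1.
  by rewrite scaler0 add0r scalerA mulrAC mulfV ?gt_eqF // mul1r.
apply: ballK; rewrite /eball /=.
(* The scaled point is [q + l0^-1 *: w], so [w] is its displacement from [q] up to scale. *)
pose w := v - (b + k) *: q.
have -> : l0^-1 *: (q + v) - (q - rho *: n) = l0^-1 *: w + rho *: n.
  rewrite opprB addrA addrAC; congr (_ + _).
  apply: (scalerI (lt0r_neq0 l0_gt0)).
  rewrite scalerBr !scalerA mulfV ?gt_eqF // !scale1r /w /l0.
  by apply/rowP => i; rewrite !mxE; ring.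
(* The linear term [b] cancels the normal component of [v]; only the inward shift due to [k]
   remains. *)
have nw : inner w n = - (k * a).
  rewrite /w innerDl innerNl innerZl !(innerC _ n) -/a mulrDl.
  by rewrite /b divfK ?gt_eqF //; ring.
have wRad : enorm w <= 3 * e * Rad.
  apply: le_trans (ler_enormD _ _) _; rewrite enormN enormZ.
  have bk : `|b + k| <= 2 * e.
    by apply: le_trans (ler_normD _ _) _; rewrite (ger0_norm k0); lra.
  have : `|b + k| * enorm q <= 2 * e * Rad.
    by apply: ler_pM; rewrite ?enorm_ge0.
  have : e * r <= e * Rad by apply: ler_wpM2l.
  lra.
have ww : inner w w <= r ^+ 2 * k.
  apply: le_trans ek; rewrite -sqr_enorm.
  have -> : 9 * e ^+ 2 * Rad ^+ 2 = (3 * e * Rad) ^+ 2 by ring.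
  rewrite ler_pXn2r ?nnegrE ?enorm_ge0 //.
  by apply: le_trans wRad; exact: enorm_ge0.
clearbody w; have rra : r ^+ 2 <= rho * a by rewrite expr2; apply: ler_pM; lra.
have rho0 : 0 < rho by lra.
rewrite -(ler_pXn2r (n := 2)) ?nnegrE ?enorm_ge0 ?(ltW rho0) //.
rewrite sqr_enorm !innerE (innerC n w) nw -(sqr_enorm n) n1.
(* Multiplied by [l0 ^+ 2], membership in the ball reads [inner w w <= 2 * l0 * (rho * a * k)],
   which follows from [ww], [rra] and [1 <= 2 * l0]. *)
rewrite -subr_ge0 -(pmulr_rge0 _ (exprn_gt0 2 l0_gt0)).
have h1 : r ^+ 2 * k <= rho * a * k by apply: ler_wpM2r.
have h2 : rho * a * k <= 2 * l0 * (rho * a * k).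
  by apply: ler_peMl => //; rewrite !mulr_ge0 // ltW.
have h3 : 0 <= 2 * l0 * (rho * a * k) - inner w w by lra.
apply: le_trans h3 _; rewrite le_eqVlt; apply/orP; left; apply/eqP.
by field; rewrite gt_eqF.
Qed.

(** * The last feasible point of a segment *)

Lemma line_point x y (t t' : R) :
  (1 - t) *: x + t *: y - ((1 - t') *: x + t' *: y) = (t - t') *: (y - x).
Proof. by apply/rowP => i; rewrite !mxE; ring. Qed.

(** Maximality of [q] excludes larger parameters; convexity between [x] and [q] gives all the
    smaller ones. *)
Lemma last_feasibleP K x y q : convex_body K -> K x -> ~ K y ->
  last_feasible K x y q ->
  exists t, [/\ 0 <= t, t < 1, q = (1 - t) *: x + t *: y &
    forall t', 0 <= t' <= 1 -> (K ((1 - t') *: x + t' *: y) <-> t' <= t)].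
Proof.
move=> bK Kx Ky [[[t /=]]]; rewrite in_itv /= => /andP[t0 t1] qE Kq far.
have dist t' : (1 - t') *: x + t' *: y - x = t' *: (y - x).
  by apply/rowP => i; rewrite !mxE; ring.
have yx : 0 < enorm (y - x).
  rewrite lt_def enorm_ge0 andbT; apply/eqP => /enorm0_eq0/eqP.
  by rewrite subr_eq0 => /eqP yx; apply: Ky; rewrite yx.
exists t; split=> //.
  rewrite lt_neqAle t1 andbT; apply/eqP => t1E; apply: Ky.
  by move: Kq; rewrite -qE t1E subrr scale0r scale1r add0r.
move=> t' /andP[t'0 t'1]; split=> [Kt'|t't].
  have := far ((1 - t') *: x + t' *: y).
  rewrite -qE !dist !enormZ !ger0_norm // ler_pM2r //; apply; split=> //.
  by exists t' => //; rewrite /= in_itv /= t'0.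
have [t0E|t_neq0] := eqVneq t 0.
  have -> : t' = 0 by lra.
  by rewrite subr0 scale1r scale0r addr0.
have t_gt0 : 0 < t by rewrite lt_def t_neq0.
have := @convex_bodyP _ _ _ bK x q (t' / t) Kx Kq.
rewrite divr_ge0 // ler_pdivrMr // mul1r -qE => /(_ isT t't).
congr (K _); apply/rowP => i; rewrite !mxE.
by field.
Qed.

(** The parameter [s] of [q] satisfies [t <= s < t'], so the accepted end of a bisection bracket
    lies before [q], within the bracket width. *)
Lemma line_search K x y q (t t' : R) : convex_body K -> K x -> ~ K y ->
  last_feasible K x y q -> 0 <= t -> t <= t' -> t' <= 1 ->
  K ((1 - t) *: x + t *: y) -> ~ K ((1 - t') *: x + t' *: y) ->
  segment x q ((1 - t) *: x + t *: y) /\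
  enorm ((1 - t) *: x + t *: y - q) <= (t' - t) * enorm (y - x).
Proof.
move=> bK Kx Ky /(last_feasibleP bK Kx Ky) [s [s0 s1 -> sP]] t0 tt' t'1 Kt Kt'.
have ts : t <= s by apply/sP => //; apply/andP; split; lra.
have st' : s < t'.
  rewrite ltNge; apply/negP => t's; apply: Kt'.
  by apply/sP => //; apply/andP; split; lra.
split.
  have [s0E|s_neq0] := eqVneq s 0.
    exists 0; first by rewrite /= in_itv /= lexx ler01.
    by apply/rowP => i; rewrite !mxE s0E (_ : t = 0); [ring|lra].
  have s_gt0 : 0 < s by rewrite lt_def s_neq0.
  exists (t / s).
    by rewrite /= in_itv /= divr_ge0 // ler_pdivrMr // mul1r.
  by apply/rowP => i; rewrite !mxE; field.
rewrite line_point enormZ; apply: ler_wpM2r; first exact: enorm_ge0.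
by rewrite ler0_norm; lra.
Qed.

(** Points of the segment just beyond [q] lie outside [K], so a supporting normal exists and [get]
    returns one. *)
Lemma last_feasible_supporting K x y q : convex_body K -> K x -> ~ K y ->
  last_feasible K x y q -> supporting_unit_normal K q (outward_normal K q).
Proof.
move=> bK Kx Ky /(last_feasibleP bK Kx Ky) [s [s0 s1 qE sP]].
apply: (@getPex _ [set n | supporting_unit_normal K q n]).
apply: supporting_unit_normal_exists => // e e0.
have h0 : 0 < e / (1 + enorm (y - x)).
  by rewrite divr_gt0 // ltr_wpDr ?enorm_ge0.
(* The first bound keeps the point on the segment, the second keeps it within [e] of [q]. *)
pose h := Num.min (1 - s) (e / (1 + enorm (y - x))).
have [hs he h_gt0] : [/\ h <= 1 - s, h <= e / (1 + enorm (y - x)) & 0 < h].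
  by rewrite /h !ge_min !lexx orbT lt_min h0 andbT; split => //; lra.
exists ((1 - (s + h)) *: x + (s + h) *: y).
  by move=> /sP; lra.
rewrite qE line_point addrAC subrr add0r enormZ gtr0_norm //.
apply: le_trans (_ : h * (1 + enorm (y - x)) <= _).
  by apply: ler_wpM2l; [exact: ltW|rewrite lerDr].
by rewrite -ler_pdivlMr // ltr_wpDr ?enorm_ge0.
Qed.

End Gauge.

(** * Composition of query algorithms and bisection *)

Section QueryAlg.
Variable T : Type.

Fixpoint qbind A B (t : query_alg T A) (k : A -> query_alg T B) :=
  match t with
  | Return a => k a
  | Query z c => Query z (fun b => qbind (c b) k)
  end.

Lemma output_qbind A B o (t : query_alg T A) (k : A -> query_alg T B) :
  output o (qbind t k) = output o (k (output o t)).
Proof. by elim: t => //= z c IH; rewrite IH. Qed.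

Lemma num_queries_qbind A B o (t : query_alg T A) (k : A -> query_alg T B) :
  num_queries o (qbind t k) =
  (num_queries o t + num_queries o (k (output o t)))%N.
Proof. by elim: t => //= z c IH; rewrite IH. Qed.

Fixpoint qmap I A (F : I -> query_alg T A) (s : seq I) : query_alg T (seq A) :=
  if s is i :: s' then
    qbind (F i) (fun a => qbind (qmap F s') (fun l => Return T (a :: l)))
  else Return T [::].

Lemma output_qmap I A o (F : I -> query_alg T A) s :
  output o (qmap F s) = [seq output o (F i) | i <- s].
Proof. by elim: s => //= i s IH; rewrite !output_qbind IH. Qed.

Lemma num_queries_qmap I A o (F : I -> query_alg T A) s m :
  (forall i, num_queries o (F i) = m) ->
  num_queries o (qmap F s) = (size s * m)%N.
Proof.
move=> Fm; elim: s => //= i s IH.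
by rewrite !num_queries_qbind IH Fm addn0 mulSn.
Qed.

Variable R : realType.

(** The left end is returned because it is the accepted one; on [[x, y]] this makes the output
    feasible. *)
Fixpoint bisect (f : R -> T) m (lo hi : R) : query_alg T R :=
  if m is m'.+1 then
    let mid := (lo + hi) / 2 in
    Query (f mid)
      (fun b => if b then bisect f m' mid hi else bisect f m' lo mid)
  else Return T lo.

Lemma num_queries_bisect (o : T -> bool) (f : R -> T) m (lo hi : R) :
  num_queries o (bisect f m lo hi) = m.
Proof. by elim: m lo hi => //= m IH lo hi; case: (o _); rewrite IH. Qed.

(** Each query halves the bracket and keeps its left end accepted and its right end rejected; [t']
    is the final right end. *)
Lemma bisectP (o : T -> bool) (f : R -> T) m (lo hi : R) :
  lo <= hi -> o (f lo) -> ~~ o (f hi) ->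
  let t := output o (bisect f m lo hi) in
  exists t', [/\ lo <= t, t <= t' <= hi, o (f t), ~~ o (f t')
    & t' - t = (hi - lo) / 2 ^+ m].
Proof.
elim: m lo hi => [|m IH] lo hi lohi olo ohi /=.
  by exists hi; rewrite lohi !lexx expr0 divr1.
have m2 : (2 ^+ m : R) != 0 by rewrite expf_neq0 // pnatr_eq0.
case: ifP => omid.
  have [|t' [h1 h2 h3 h4 h5]] := IH ((lo + hi) / 2) hi _ omid ohi; first by lra.
  exists t'; split=> //; first by lra.
  by rewrite h5 exprS; field.
have [|t' [h1 h2 h3 h4 h5]] := IH lo ((lo + hi) / 2) _ olo (negbT omid).
  by lra.
exists t'; split=> //; first by lra.
by rewrite h5 exprS; field.
Qed.

End QueryAlg.

Arguments bisect : simpl never.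

(** * Finite differences of the gauge *)

Section Estimate.
Variables (R : realType) (d : nat).
Implicit Types (u v w x y z q n : 'rV[R]_d) (K : set 'rV[R]_d).

(* [t] stands for minus the gauge value, so that membership of [(-t)^-1 *: z]
   holds at the left end of the interval and fails at the right end. *)
Definition gauge_search m z : query_alg 'rV[R]_d R :=
  bisect (fun t => (- t)^-1 *: z) m (- 2) (- 2^-1).

(** The supporting half-space bounds the accepted value from below, the inner ball bounds the
    rejected one from above, and they differ by the bracket width [3 / 2 / 2 ^+ m]. *)
Lemma gauge_searchP K q n v (rho r Rad e k : R) m :
  convex_body K -> K 0 -> supporting_unit_normal K q n ->
  eball (q - rho *: n) rho `<=` K ->
  0 < r -> r <= rho -> r <= inner n q -> enorm q <= Rad -> r <= Rad ->
  enorm v <= e * r -> 0 <= e -> 4 * e <= 1 -> 0 <= k -> k <= e ->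
  9 * e ^+ 2 * Rad ^+ 2 <= r ^+ 2 * k ->
  let l := - output (membership_oracle K) (gauge_search m (q + v)) in
  1 + inner n v / inner n q <= l <= 1 + inner n v / inner n q + k + 2 / 2 ^+ m.
Proof.
move=> bK K0 nK ballK r0 r_rho ra qRad r_Rad ve e0 e4 k0 ke ek.
have n1 := nK.1.
have a0 : 0 < inner n q by lra.
have upper l : 1 + inner n v / inner n q + k <= l -> K (l^-1 *: (q + v)).
  by apply: (@gauge_le_quadratic _ _ K q n v rho r Rad e k l) => //; lra.
have lower l : 0 < l -> K (l^-1 *: (q + v)) -> 1 + inner n v / inner n q <= l.
  move=> l0 /(support_gauge_le l0 nK); rewrite innerDr.
  rewrite -ler_pdivrMr // mulrDl mulfV ?gt_eqF //.
have : `|inner n v / inner n q| <= e.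
  rewrite normrM normfV (gtr0_norm a0) ler_pdivrMr //.
  apply: le_trans (cauchy_schwarz _ _) _; rewrite n1 mul1r.
  by apply: le_trans ve _; apply: ler_wpM2l.
rewrite ler_norml => /andP[b1 b2].
(* The linear term and [k] are at most [e <= 1 / 4] in absolute value, so 2 is accepted and [2^-1]
   is rejected. *)
have [|||t' [h1 /andP[h2 h3] h4 h5 h6]] :=
    @bisectP _ _ (membership_oracle K) (fun t => (- t)^-1 *: (q + v)) m
      (- 2) (- 2^-1).
- lra.
- by apply/asboolP; apply: upper; lra.
- by apply/asboolP => /lower; lra.
rewrite -/(gauge_search m (q + v)) in h1 h2 h4 h6 *.
move: (output _ _) h1 h2 h4 h6 => t h1 h2 /asboolP h4 h6 /=.
have l1 := lower _ _ h4.
have l2 : - t' < 1 + inner n v / inner n q + k.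
  by rewrite ltNge; apply/negP => /upper Kt'; move/asboolP: h5; apply.
have : (- 2^-1 - - 2) / 2 ^+ m <= 2 / 2 ^+ m :> R.
  by apply: ler_wpM2r; [rewrite invr_ge0 exprn_ge0|lra].
by move=> h; apply/andP; split; lra.
Qed.

(** The difference quotient uses the value 1 of the gauge at [q] although it starts from [p]; this
    costs [eps], and the gauge error costs [Rad * (k + eta)]. The unknown factor [inner n q]
    disappears on normalization. *)
Lemma normal_coord_estimate q n p (i : 'I_d) (s eps l k eta Rad : R) :
  enorm n = 1 -> 0 < s -> 0 < inner n q -> inner n q <= Rad ->
  enorm (p - q) <= eps ->
  0 <= k + eta ->
  let b := inner n (p - q + s *: delta_mx 0 i) / inner n q in
  1 + b <= l <= 1 + b + k + eta ->
  `|inner n q * ((l - 1) / s) - n 0 i| <= (eps + Rad * (k + eta)) / s.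
Proof.
move=> n1 s0 a0 aRad pq keta b /andP[l1 l2].
have ab : inner n q * b = inner n (p - q) + s * n 0 i.
  by rewrite mulrC divfK ?gt_eqF // innerDr innerZr inner_delta.
have -> : inner n q * ((l - 1) / s) - n 0 i =
    (inner n q * (l - 1 - b) + inner n (p - q)) / s.
  have -> : inner n (p - q) = inner n q * b - s * n 0 i by rewrite ab addrK.
  by field; rewrite gt_eqF.
rewrite normrM normfV (gtr0_norm s0) ler_pM2r ?invr_gt0 //.
apply: le_trans (ler_normD _ _) _; rewrite addrC; apply: lerD.
  by apply: le_trans (cauchy_schwarz _ _) _; rewrite n1 mul1r.
rewrite ger0_norm; last by rewrite mulr_ge0 //; lra.
by apply: ler_pM; lra.
Qed.

End Estimate.

(** * The procedure, its parameters and its query count *)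

Section Procedure.
Variable R : realType.

(** The exponent is [18 = 10 + 2 + 4 + 2]: numerical constants, then the powers of [d], [Rad / r]
    and [Rad / delta] in [steps_enough]. *)
Definition steps (M : R) : nat := (Num.truncn (18 * ln M / ln 2)).+1.

Lemma ln2_gt0 : 0 < ln 2 :> R.
Proof. by rewrite ln_gt0 // ltr1n. Qed.

Lemma exp_steps (M : R) : 0 < M -> M ^+ 18 <= 2 ^+ steps M.
Proof.
move=> M0; rewrite -ler_ln ?posrE ?exprn_gt0 // !lnXn // -!(mulr_natl (ln _)).
by rewrite -ler_pdivrMr ?ln2_gt0 // ltW // truncnS_gt.
Qed.

(** The rounding by one is absorbed by [1 <= ln M / ln 2], which turns 18 into 19. *)
Lemma steps_le (M : R) : 2 <= M -> (steps M)%:R <= 19 / ln 2 * ln M.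
Proof.
move=> M2; have M0 : 0 < M by lra.
have l2 := ln2_gt0; have lM : ln 2 <= ln M by rewrite ler_ln ?posrE.
rewrite /steps -natr1; apply: (@le_trans _ _ (18 * ln M / ln 2 + ln M / ln 2)).
  apply: lerD; first by rewrite truncn_le divr_ge0 ?mulr_ge0 //; lra.
  by rewrite ler_pdivlMr // mul1r.
by rewrite le_eqVlt; apply/orP; left; apply/eqP; field; rewrite gt_eqF.
Qed.

(* With this [s] the quadratic part of the error is [delta / (12 * Rad)]. *)
Definition find_normal (d : nat) (rho r Rad : R) (x y : 'rV[R]_d) (delta : R) :
    query_alg 'rV[R]_d ('rV[R]_d * 'rV[R]_d) :=
  let m := steps (d%:R + Rad / r + Rad / delta) in
  let s := delta * r ^+ 4 / (432 * d%:R * Rad ^+ 4) in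
  qbind (bisect (fun t => (1 - t) *: x + t *: y) m 0 1) (fun t =>
    let p := (1 - t) *: x + t *: y in
    qbind (qmap (fun i => gauge_search m (p + s *: delta_mx 0 i)) (enum 'I_d))
      (fun ts =>
        let g := \row_i ((- ts`_i - 1) / s) in
        Return _ (p, (enorm g)^-1 *: g))).

Lemma num_queries_find_normal d rho r Rad x y delta o :
  num_queries o (@find_normal d rho r Rad x y delta) =
  (d.+1 * steps (d%:R + Rad / r + Rad / delta))%N.
Proof.
rewrite /find_normal num_queries_qbind num_queries_bisect.
set m := steps _; rewrite num_queries_qbind (num_queries_qmap _ (m := m)).
  by rewrite size_enum_ord addn0 mulSn.
by move=> i; rewrite num_queries_bisect.
Qed.

Lemma stencil_gt0 (d : nat) (r Rad delta : R) :
  (0 < d)%N -> 0 < r -> 0 < Rad -> 0 < delta ->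
  0 < delta * r ^+ 4 / (432 * d%:R * Rad ^+ 4).
Proof.
move=> d0 r0 Rad0 delta0; apply: divr_gt0.
  by apply: mulr_gt0 => //; exact: exprn_gt0.
apply: mulr_gt0; last exact: exprn_gt0.
by apply: mulr_gt0; rewrite ltr0n.
Qed.

Lemma steps_enough (d : nat) (r Rad delta : R) : 
  (0 < d)%N -> 0 < r -> r <= Rad -> 0 < delta -> delta <= r ->
  48 * d%:R * Rad ^+ 2 <=
  2 ^+ steps (d%:R + Rad / r + Rad / delta) *
    (delta * r ^+ 4 / (432 * d%:R * Rad ^+ 4)) * delta.
Proof.
move=> d0 r0 r_Rad delta0 delta_r.
have Rad0 : 0 < Rad by lra.
have d1 : 1 <= d%:R :> R by rewrite ler1n.
have A1 : 1 <= Rad / r by rewrite ler_pdivlMr // mul1r.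
have B1 : 1 <= Rad / delta by rewrite ler_pdivlMr // mul1r; lra.
set M := _ + _ + _.
have M3 : 3 <= M by rewrite /M; lra.
have M0 : 0 < M by lra.
apply: (@le_trans _ _
    (M ^+ 18 * (delta * r ^+ 4 / (432 * d%:R * Rad ^+ 4)) * delta)); last first.
  apply: ler_wpM2r; first exact: ltW.
  apply: ler_wpM2r; last exact: exp_steps.
  by apply: ltW; apply: stencil_gt0.
have key (c : R) : 0 <= c -> c <= 3 ^+ 10 ->
    c * d%:R ^+ 2 * (Rad / r) ^+ 4 * (Rad / delta) ^+ 2 <= M ^+ 18.
  move=> c0 c310.
  have -> : M ^+ 18 = M ^+ 10 * M ^+ 2 * M ^+ 4 * M ^+ 2 by rewrite -!exprD.
  have ge0 (a : R) j : 1 <= a -> 0 <= a ^+ j.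
    by move=> a1; rewrite exprn_ge0 //; lra.
  have pw (a : R) j : 1 <= a -> a <= M -> a ^+ j <= M ^+ j.
    by move=> a1 aM; apply: lerXn2r; rewrite ?nnegrE //; lra.
  have dM : d%:R <= M by rewrite /M; lra.
  have AM : Rad / r <= M by rewrite /M; lra.
  have BM : Rad / delta <= M by rewrite /M; lra.
  have cM : c <= M ^+ 10 by apply: le_trans c310 _; apply: pw; lra.
  have c1 := mulr_ge0 c0 (ge0 _ 2%N d1).
  have c2 := mulr_ge0 c1 (ge0 _ 4%N A1).
  apply: ler_pM c2 (ge0 _ _ B1) _ (pw _ _ B1 BM).
  apply: ler_pM c1 (ge0 _ _ A1) _ (pw _ _ A1 AM).
  exact: ler_pM c0 (ge0 _ _ d1) cM (pw _ _ d1 dM).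
(* [20736 = 48 * 432], and it is below [3 ^+ 10]; the factor [c0] below turns [key] into the
   goal. *)
have {}key := key 20736 ltac:(lra) ltac:(lra).
have d_gt0 : 0 < d%:R :> R by rewrite ltr0n.
have c0 : 0 < Rad ^+ 2 / (432 * d%:R * (Rad / r) ^+ 4 * (Rad / delta) ^+ 2).
  apply: divr_gt0; first exact: exprn_gt0.
  apply: mulr_gt0; last by apply: exprn_gt0; apply: divr_gt0.
  apply: mulr_gt0; last by apply: exprn_gt0; apply: divr_gt0.
  by apply: mulr_gt0; rewrite ?ltr0n.
move: key; move: (M ^+ 18) => {M M3 M0} M; rewrite -(ler_pM2r c0) => key.
apply: (le_trans (le_trans _ key)); rewrite le_eqVlt; apply/orP; left;
  by apply/eqP; field; rewrite !gt_eqF.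
Qed.

(** With [e = 2 * s / r] and [P = 2 ^+ m], the first two bounds give [k <= e] and [4 * e <= 1], the
    next two control the distance from [qhat] to [q], and the last is the total coordinate error. *)
Lemma stencil_bounds (D r Rad delta P s : R) :
  1 <= D -> 0 < r -> r <= Rad -> 0 < delta -> delta <= r -> 0 < P ->
  s = delta * r ^+ 4 / (432 * D * Rad ^+ 4) -> 0 < s ->
  48 * D * Rad ^+ 2 <= P * s * delta ->
  [/\ 18 * s * Rad ^+ 2 <= r ^+ 3, 18 * s <= r, s <= delta, 2 * Rad / P <= s &
    D * ((2 * Rad / P + Rad * (36 * s ^+ 2 * Rad ^+ 2 / r ^+ 4 + 2 / P)) / s) <=
      delta / (6 * Rad)].
Proof.
move=> D1 r0 r_Rad delta0 delta_r P0 sE s0 enough.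
have Rad0 : 0 < Rad by lra.
have D0 : 0 < D by lra.
have r2 : r ^+ 2 <= Rad ^+ 2 by apply: lerXn2r; rewrite ?nnegrE // ltW.
have r4 : r ^+ 4 <= Rad ^+ 4 by apply: lerXn2r; rewrite ?nnegrE // ltW.
have Rad2 : 0 < Rad ^+ 2 by exact: exprn_gt0.
have Rad4 : 0 < Rad ^+ 4 by exact: exprn_gt0.
have sR : 18 * s * Rad ^+ 4 <= delta * r ^+ 4.
  have -> : delta * r ^+ 4 = 432 * D * (s * Rad ^+ 4).
    by rewrite sE; field; rewrite !gt_eqF.
  have : 0 < s * Rad ^+ 4 by exact: mulr_gt0.
  rewrite -(mulrA 18 s); move: (s * Rad ^+ 4) => X X0; nra.
have b1 : 18 * s * Rad ^+ 2 <= r ^+ 3.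
  rewrite -(ler_pM2r Rad2).
  have -> : 18 * s * Rad ^+ 2 * Rad ^+ 2 = 18 * s * Rad ^+ 4 by ring.
  apply: le_trans sR _.
  have -> : r ^+ 3 * Rad ^+ 2 = r * (r ^+ 2 * Rad ^+ 2) by ring.
  have -> : delta * r ^+ 4 = delta * (r ^+ 2 * r ^+ 2) by ring.
  apply: ler_pM => //; [exact: ltW|by rewrite mulr_ge0 ?sqr_ge0|].
  by apply: ler_wpM2l => //; exact: sqr_ge0.
split=> //.
- rewrite -(ler_pM2r Rad2); apply: le_trans b1 _.
  by rewrite exprS; apply: ler_wpM2l => //; exact: ltW.
- rewrite -(ler_pM2r Rad4).
  have : delta * r ^+ 4 <= delta * Rad ^+ 4.
    by apply: ler_wpM2l => //; exact: ltW.
  have : 0 < s * Rad ^+ 4 by exact: mulr_gt0.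
  rewrite -mulrA in sR; move: (s * _) sR => X; lra.
- rewrite ler_pdivrMr // -(ler_pM2r Rad0) (mulrC s).
  have : P * s * delta <= P * s * Rad.
    by apply: ler_wpM2l; [rewrite mulr_ge0 // ltW|lra].
  have : Rad ^+ 2 <= D * Rad ^+ 2 by apply: ler_peMl => //; exact: ltW.
  have -> : 2 * Rad * Rad = 2 * Rad ^+ 2 by ring.
  rewrite -mulrA in enough; move: (D * _) enough => X; lra.
- have -> : D * ((2 * Rad / P +
        Rad * (36 * s ^+ 2 * Rad ^+ 2 / r ^+ 4 + 2 / P)) / s) =
      4 * D * Rad / (P * s) + 36 * D * s * Rad ^+ 3 / r ^+ 4.
    by field; rewrite !gt_eqF.
  (* Half of the budget goes to the bisections, which explains the 48 in [enough], and half to the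
     quadratic error, which the formula for [s] uses up exactly. *)
  have -> : delta / (6 * Rad) = delta / (12 * Rad) + delta / (12 * Rad).
    by field; rewrite gt_eqF.
  apply: lerD; last first.
    by rewrite sE le_eqVlt; apply/orP; left; apply/eqP; field; rewrite !gt_eqF.
  have P12 : 0 < 12 * Rad by lra.
  rewrite ler_pdivrMr ?mulr_gt0 // [leRHS]mulrAC ler_pdivlMr //.
  move: enough; lra.
Qed.

(** * Correctness of the procedure *)

Lemma find_normal_correct (d : nat) (rho r Rad : R) (K : set 'rV[R]_d)
    (x y q : 'rV[R]_d) (delta : R) :
  smooth_body rho K -> 0 < r -> r <= rho -> rho <= Rad ->
  eball 0 r `<=` K -> K `<=` eball 0 Rad ->
  K x -> ~ K y -> enorm (y - x) <= 2 * Rad ->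
  last_feasible K x y q -> 0 < delta -> delta <= r -> (0 < d)%N ->
  let out := output (membership_oracle K) (find_normal rho r Rad x y delta) in
  [/\ segment x q out.1 /\ K out.1, enorm out.2 = 1, enorm (out.1 - q) <= delta
    & enorm (out.2 - outward_normal K q) <= delta / (2 * Rad + rho)].
Proof.
move=> [bK smK] r0 r_rho rho_Rad rK KRad Kx Ky xyRad lq delta0 delta_r d0.
have r_Rad : r <= Rad by lra.
have Rad0 : 0 < Rad by lra.
have d_gt0 : 0 < d%:R :> R by rewrite ltr0n.
have nK := last_feasible_supporting bK Kx Ky lq.
set n := outward_normal K q in nK *.
have n1 := nK.1.
have Kq : K q by case: lq => -[].
have ballK := smK q n (boundary_supporting Kq nK) nK.
have K0 : K 0.
  apply: rK; rewrite /eball /= subrr.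
  by rewrite /enorm -(scale0r 0) innerZl mul0r sqrtr0 ltW.
have qRad : enorm q <= Rad by have := KRad q Kq; rewrite /eball /= subr0.
have ra := support_ge (ltW r0) rK nK.
have aRad : inner n q <= Rad.
  by apply: le_trans (ler_inner _ _) _; rewrite n1 mul1r.
have enough := steps_enough d0 r0 r_Rad delta0 delta_r.
rewrite /find_normal output_qbind; cbv beta zeta.
rewrite output_qbind output_qmap.
set m := steps _ in enough *; set s := delta * r ^+ 4 / _ in enough *.
have s0 : 0 < s by exact: stencil_gt0.
have m0 : 0 < 2 ^+ m :> R by rewrite exprn_gt0.
have [|||t' [t0 /andP[tt' t'1] /asboolP Kt /asboolP Kt' t'E]] :=
    @bisectP _ _ (membership_oracle K) (fun t => (1 - t) *: x + t *: y) m 0 1.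
- exact: ler01.
- by apply/asboolP; rewrite subr0 scale1r scale0r addr0.
- by apply/asboolP; rewrite subrr scale1r scale0r add0r.
move: (output _ _) t0 tt' Kt t'E => t t0 tt' Kt t'E.
have [seg dist] := line_search bK Kx Ky lq t0 tt' t'1 Kt Kt'.
set p := _ + _ in seg dist Kt *.
have {}dist : enorm (p - q) <= 2 * Rad / 2 ^+ m.
  apply: le_trans dist _; rewrite t'E subr0 mul1r mulrC.
  by apply: ler_wpM2r; rewrite // invr_ge0 ltW.
have [b1 b2 b3 b4 b5] := stencil_bounds (P := 2 ^+ m) (s := s)
  (D := d%:R) ltac:(by rewrite ler1n) r0 r_Rad delta0 delta_r m0 erefl s0 enough.
(* This is [9 * (e * Rad / r) ^+ 2] for [e = 2 * s / r]. *)
set k := 36 * s ^+ 2 * Rad ^+ 2 / r ^+ 4 in b5.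
have r3 : 0 < r ^+ 3 by exact: exprn_gt0.
clearbody s m; have k0 : 0 <= k.
  apply: divr_ge0; last by apply: exprn_ge0; exact: ltW.
  by apply: mulr_ge0; [apply: mulr_ge0|]; rewrite ?sqr_ge0 ?ler0n.
have e0 : 0 <= 2 * s / r by apply: divr_ge0; lra.
have eta0 : 0 <= 2 / 2 ^+ m :> R by apply: divr_ge0; lra.
have ke : k <= 2 * s / r.
  have -> : k = 2 * s / r * (18 * s * Rad ^+ 2 / r ^+ 3).
    by rewrite /k; field; rewrite gt_eqF.
  apply: ler_piMr; first exact: e0.
  by rewrite ler_pdivrMr // mul1r.
have ek : 9 * (2 * s / r) ^+ 2 * Rad ^+ 2 <= r ^+ 2 * k.
  by rewrite /k le_eqVlt; apply/orP; left; apply/eqP; field; rewrite gt_eqF.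
have bound (i : 'I_d) :
    let l := - output (membership_oracle K)
      (gauge_search m (p + s *: delta_mx 0 i)) in
    `|inner n q * ((l - 1) / s) - n 0 i| <=
      (2 * Rad / 2 ^+ m + Rad * (k + 2 / 2 ^+ m)) / s.
  (* The gauge is expanded at [q], not at [p]; as [p] is within [s] of [q], the displacement [v] has
     length at most [2 * s]. *)
  move=> l; pose v := p - q + s *: delta_mx 0 i.
  have pE : p + s *: delta_mx 0 i = q + v by rewrite /v addrA subrKC.
  have ve : enorm v <= 2 * s / r * r.
    rewrite divfK ?gt_eqF //; apply: le_trans (ler_enormD _ _) _.
    by rewrite enormZ enorm_delta mulr1 gtr0_norm //; lra.
  apply: (normal_coord_estimate n1 s0 _ aRad dist); [lra|exact: addr_ge0|].
  have e4 : 4 * (2 * s / r) <= 1 by rewrite mulrA ler_pdivrMr //; lra.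
  have := gauge_searchP m bK K0 nK ballK r0 r_rho ra qRad r_Rad ve e0 e4
    k0 ke ek.
  by rewrite -pE.
set g := \row_i _.
have ag : enorm (inner n q *: g - n) <= delta / (6 * Rad).
  apply: le_trans b5; apply: enorm_le_coord.
    apply: divr_ge0; last exact: ltW.
    apply: addr_ge0; first by apply: le_trans dist; exact: enorm_ge0.
    by apply: mulr_ge0; [exact: ltW|exact: addr_ge0].
  move=> i; rewrite !mxE (nth_map i) ?size_enum_ord // nth_ord_enum.
  exact: bound.
have dR : delta / (6 * Rad) < 1 by rewrite ltr_pdivrMr ?mulr_gt0 //; lra.
have a0 : 0 < inner n q by lra.
have [g1 g2] := normalize_close a0 n1 dR ag.
split=> //; first by lra.
apply: le_trans g2 _.
(* Since [rho <= Rad], the denominator [2 * Rad + rho] is at most [3 * Rad]. *)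
have -> : 2 * (delta / (6 * Rad)) = delta / (3 * Rad) by field; rewrite gt_eqF.
by apply: ler_wpM2l; [exact: ltW|rewrite lef_pV2 ?posrE; lra].
Qed.

End Procedure.

Unset Implicit Arguments.

Theorem lemmaB1 (R : realType) :
  exists C : R, 0 < C /\
  (* arguments of the procedure: d, rho, r, Rad, x, y, delta *)
  exists alg : forall d : nat, R -> R -> R -> 'rV[R]_d -> 'rV[R]_d -> R ->
                 query_alg 'rV[R]_d ('rV[R]_d * 'rV[R]_d),
  forall (d : nat) (rho r Rad : R) (K : set 'rV[R]_d)
         (x y q : 'rV[R]_d) (delta : R),
    smooth_body rho K ->
    0 < r -> r <= rho -> rho <= Rad ->
    eball 0 r `<=` K -> K `<=` eball 0 Rad ->
    K x -> ~ K y -> enorm (y - x) <= 2 * Rad ->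
    last_feasible K x y q ->
    0 < delta -> delta <= r ->
    let A := alg d rho r Rad x y delta in
    let o := membership_oracle K in
    let qhat := (output o A).1 in
    let ntilde := (output o A).2 in
    [/\ segment x q qhat /\ K qhat,
        enorm ntilde = 1,
        enorm (qhat - q) <= delta,
        enorm (ntilde - outward_normal K q) <= delta / (2 * Rad + rho)
      & (num_queries o A)%:R <= C * d%:R * ln (d%:R + Rad / r + Rad / delta)].
Proof.
exists (38 / ln 2); split; first by rewrite divr_gt0 ?ln2_gt0.
exists (@find_normal R) => d rho r Rad K x y q delta smK r0 r_rho rho_Rad rK
  KRad Kx Ky xyRad lq delta0 delta_r A o qhat ntilde.
(* In dimension 0 the points [x] and [y] coincide, so they cannot lie on different sides. *)
have d0 : (0 < d)%N.
  rewrite lt0n; apply/eqP => dE; apply: Ky; suff -> : y = x by [].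
  apply/rowP => i; exfalso.
  by have := leq_ltn_trans (leq0n i) (ltn_ord i); rewrite dE.
have [h1 h2 h3 h4] := find_normal_correct smK r0 r_rho rho_Rad rK KRad Kx Ky
  xyRad lq delta0 delta_r d0.
split=> //; rewrite /A num_queries_find_normal natrM.
set M := _ + _ + _.
have M2 : 2 <= M.
  have : 1 <= d%:R :> R by rewrite ler1n.
  have : 1 <= Rad / r by rewrite ler_pdivlMr // mul1r; lra.
  have : 0 <= Rad / delta by rewrite divr_ge0 //; lra.
  by rewrite /M; lra.
(* There are [d.+1 <= 2 * d] bisections, each bounded by [steps_le]. *)
have -> : 38 / ln 2 * d%:R * ln M = (2 * d%:R) * (19 / ln 2 * ln M) by ring.
apply: ler_pM => //; last exact: steps_le.
by rewrite -natrM ler_nat mul2n -addnn -addn1 leq_add2l.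
Qed.
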